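(* Let $X$ and $U$ be non-trivial complex Hilbert spaces, let $\widetilde x_1=(\widetilde x_1(k))_{k\in\mathbb N}$ and $\widetilde x_0=(\widetilde x_0(k))_{k\in\mathbb N}$ be Bessel sequences in $X$, and let $\widetilde u_0=(\widetilde u_0(k))_{k\in\mathbb N}$ be a Bessel sequence in $U$. Let $\widetilde\Xi_1,\widetilde\Xi_0\in\mathcal L(\ell^2(\mathbb N),X)$ and $\widetilde\Upsilon_0\in\mathcal L(\ell^2(\mathbb N),U)$ be the synthesis operators associated with $\widetilde x_1,\widetilde x_0,\widetilde u_0$, respectively. Assume that $\widetilde x_0$ is a frame for $X$ and that there exist a right inverse $\widetilde\Xi_0^\dagger\in\mathcal L(X,\ell^2(\mathbb N))$ of $\widetilde\Xi_0$ and constants $M\ge1$ and $\gamma>0$ such that $$\|(\widetilde\Xi_1\widetilde\Xi_0^\dagger)^k\|\le M\gamma^k\qquad\text{for all }k\in\mathbb N_0.$$ Then $K:=\widetilde\Upsilon_0\widetilde\Xi_0^\dagger\in\mathcal L(X,U)$ satisfies $\widetilde\Sigma_{\mathrm{is}}(c_1,c_0,\widetilde\Xi_0^\dagger)\subseteq\Sigma_{K,M,\widetilde\gamma}$ for all $c_1\ge0$ and $0\le c_0<1/M$, where $$\widetilde\gamma:=\frac{1+Mc_1}{1-Mc_0}\,\gamma>0.$$ In particular, if $c_1,c_0\ge0$ satisfy $$\gamma c_1+c_0<\frac{1-\gamma}{M},$$ then $\widetilde\gamma\in(0,1)$ and $(\widetilde x_1,\widetilde x_0,\widetilde u_0)$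 are informative for stabilization with decay rate $\widetilde\gamma$ under the noise class $\mathcal N(c_1,c_0,\widetilde\Xi_0^\dagger)$.
   Context: $\mathcal L(Y,Z)$ denotes the bounded linear operators from $Y$ to $Z$, $\mathcal L(Y)=\mathcal L(Y,Y)$; $\mathbb N=\{1,2,\dots\}$, $\mathbb N_0=\mathbb N\cup\{0\}$; $X\times U$ carries the standard product inner product; $S\le T$ for self-adjoint operators means that $T-S$ is positive semidefinite. A sequence $(\eta_k)_{k\in\mathbb N}$ in a Hilbert space $Y$ is a Bessel sequence if there is $\alpha>0$ with $\sum_{k}|\langle y,\eta_k\rangle|^2\le\alpha\|y\|^2$ for all $y\in Y$; it is a frame for $Y$ if there are $\alpha,\beta>0$ with $\beta\|y\|^2\le\sum_k|\langle y,\eta_k\rangle|^2\le\alpha\|y\|^2$ for all $y\in Y$. The synthesis operator of a Bessel sequence is the bounded operator $\ell^2(\mathbb N)\to Y$, $w=(w_k)\mapsto\sum_{k=1}^\infty w_k\eta_k$. Noise consists of triples $(\delta_1,\delta_0,\theta_0)$ where $\delta_1,\delta_0$ are Bessel sequences in $X$ and $\theta_0$ is a Bessel sequence in $U$; their synthesis operators are denoted $\Delta_1,\Delta_0,\Theta_0$. For $c_1,c_0\ge0$ and $\Omega\in\mathcal L(X,\ell^2(\mathbb N))$, the noise class $\mathcal N(c_1,c_0,\Omega)$ is the set of all such triples with $$\Delta_1\Omega\Omega^*\Delta_1^*\le c_1^2\,\widetilde\Xi_1\Omega\Omega^*\widetilde\Xi_1^*\quad\text{(on }X)$$ and $$\begin{bmatrix}\Delta_0\\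 \Theta_0\end{bmatrix}\Omega\Omega^*\begin{bmatrix}\Delta_0^*&\Theta_0^*\end{bmatrix}\le c_0^2\begin{bmatrix}\widetilde\Xi_0\\ \widetilde\Upsilon_0\end{bmatrix}\Omega\Omega^*\begin{bmatrix}\widetilde\Xi_0^*&\widetilde\Upsilon_0^*\end{bmatrix}\quad\text{(on }X\times U).$$ $\widetilde\Sigma_{\mathrm{is}}(c_1,c_0,\Omega)$ is the set of $(A,B)\in\mathcal L(X)\times\mathcal L(U,X)$ for which there exists $(\delta_1,\delta_0,\theta_0)\in\mathcal N(c_1,c_0,\Omega)$ such that $\widetilde x_1(k)-\delta_1(k)=A(\widetilde x_0(k)-\delta_0(k))+B(\widetilde u_0(k)-\theta_0(k))$ for all $k\in\mathbb N$. For $K\in\mathcal L(X,U)$, $M\ge1$, $\gamma>0$: $\Sigma_{K,M,\gamma}:=\{(A,B)\in\mathcal L(X)\times\mathcal L(U,X):\|(A+BK)^k\|\le M\gamma^k\ \text{for all }k\in\mathbb N_0\}$. For $\gamma\in(0,1)$, the noisy data $(\widetilde x_1,\widetilde x_0,\widetilde u_0)$ are informative for stabilization with decay rate $\gamma$ under the noise class $\mathcal N(c_1,c_0,\Omega)$ if there exist $K\in\mathcal L(X,U)$ and $M\ge1$ such that $\widetilde\Sigma_{\mathrm{is}}(c_1,c_0,\Omega)\subseteq\Sigma_{K,M,\gamma}$. *)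

(* Defs.v *)
From HB Require Import structures.
From mathcomp Require Import all_boot all_order all_algebra sesquilinear.
From mathcomp Require Import complex.
From mathcomp Require Import all_classical all_reals.
From mathcomp Require Import ereal topology normedtype sequences.
From mathcomp Require Import ring lra.

Set Implicit Arguments.
Unset Strict Implicit.
Unset Printing Implicit Defensive.

Import Order.TTheory GRing.Theory Num.Theory.
Import numFieldNormedType.Exports.

Local Open Scope classical_set_scope.
Local Open Scope ring_scope.
Local Open Scope complex_scope.

(* Inner products are linear in the first argument, as in sesquilinear.v. *)
HB.mixin Record hasInner (R : realType) H & GRing.Lmodule R[i] H := {
  inner : {dot H for @Num.conj_op R[i]}
}.

#[short(type="innerProductType")]
HB.structure Definition InnerProduct (R : realType) :=
  {H of GRing.Lmodule R[i] H & hasInner R H}.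

HB.mixin Record InnerNormed_isHilbert (R : realType) H
    & hasInner R H & CompleteNormedModule R[i] H := {
  normr_inner : forall x : H, `|x| ^+ 2 = inner x x
}.

#[short(type="hilbertType")]
HB.structure Definition Hilbert (R : realType) :=
  {H of InnerProduct R H & CompleteNormedModule R[i] H
      & InnerNormed_isHilbert R H}.

(* Norms over R[i] take their values in R[i]; rnorm is the real-valued norm. It
   applies to vectors and to scalars alike. *)
Section rnorm.
Context {R : realType} {V : normedZmodType R[i]}.

Definition rnorm (x : V) : R := complex.Re `|x|.

Lemma rnormE x : `|x| = (rnorm x)%:C.
Proof.
by have := ger0_Im (normr_ge0 x); rewrite /rnorm; case: `|x| => a b /= ->.
Qed.

Lemma rnorm_ge0 x : 0 <= rnorm x.
Proof. by rewrite -ler0c -rnormE normr_ge0. Qed.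
End rnorm.

(* The product inner product on X * Y. The library's norm on X * Y is the
   sup norm, so that X * Y is an innerProductType but not a hilbertType. *)
Section prod_inner.
Variables (R : realType) (X Y : innerProductType R).

Definition prod_inner (p q : X * Y) : R[i] :=
  inner p.1 q.1 + inner p.2 q.2.

Fact prod_inner_bilinear :
  bilinear_for *%R (Num.conj_op \; *%R) prod_inner.
Proof.
split=> u a x y; rewrite /prod_inner /=.
  by rewrite !linearPl /= mulrDr addrACA.
by rewrite !linearPr /= mulrDr addrACA.
Qed.

HB.instance Definition _ := bilinear_isBilinear.Build
  R[i] (X * Y)%type (X * Y)%type R[i] *%R (Num.conj_op \; *%R)
  prod_inner prod_inner_bilinear.

Fact prod_inner_hermitian (p q : X * Y) :
  prod_inner p q = (-1) ^+ false * (prod_inner q p)^*%R.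
Proof.
rewrite /prod_inner rmorphD /= expr0 mul1r.
by congr (_ + _); rewrite hermC expr0 mul1r.
Qed.

HB.instance Definition _ := isHermitianSesquilinear.Build
  R[i] (X * Y)%type false Num.conj_op prod_inner prod_inner_hermitian.

Fact prod_inner_gt0 (p : X * Y) : p != 0 -> 0 < prod_inner p p.
Proof.
case: p => x y; rewrite /prod_inner /= => xy0.
have : (x != 0) || (y != 0) by rewrite -negb_and; apply: contra xy0 => /andP[/eqP-> /eqP->].
have x0 : 0 <= inner x x by exact: dnorm_ge0.
have y0 : 0 <= inner y y by exact: dnorm_ge0.
by case/orP => h; [apply: ltr_pwDl | apply: ltr_wpDl]; rewrite ?dnorm_gt0.
Qed.

HB.instance Definition _ := isDotProduct.Build
  R[i] (X * Y)%type prod_inner prod_inner_gt0.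
HB.instance Definition _ := hasInner.Build R (X * Y)%type prod_inner.
End prod_inner.

(* The versions in sesquilinear.v are restricted to finite dimension. *)
Section dot_norm.
Variables (C : numClosedFieldType) (U : lmodType C) (f : {dot U for Num.conj_op}).

Lemma dot_CauchySchwarz u v : `|f u v| <= sqrtC (f u u) * sqrtC (f v v).
Proof.
rewrite -ler_sqr ?nnegrE ?mulr_ge0 ?sqrtC_ge0 ?dnorm_ge0 //.
rewrite exprMn !sqrtCK.
have [->|v0] := eqVneq v 0; first by rewrite !linear0r normr0 expr0n mulr0.
have fvv : 0 < f v v by rewrite dnorm_gt0.
pose a := f u v / f v v.
have : 0 <= f (u - a *: v) (u - a *: v) by exact: dnorm_ge0.
have ov : f (u - a *: v) v = 0.
  by rewrite linearBl /= linearZl_LR divfK ?subrr // gt_eqF.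
rewrite [X in 0 <= X]linearBr linearZr_LR /= ov mulr0 subr0 linearBl /= linearZl_LR.
rewrite subr_ge0 /a mulrAC ler_pdivrMr // normCK.
by rewrite /= (_ : f v u = (f u v)^*%R) // hermC expr0 mul1r.
Qed.

Lemma dot_triangle u v :
  sqrtC (f (u + v) (u + v)) <= sqrtC (f u u) + sqrtC (f v v).
Proof.
rewrite -ler_sqr ?nnegrE ?addr_ge0 ?sqrtC_ge0 ?dnorm_ge0 //.
rewrite sqrrD !sqrtCK dnormD addrAC lerD2r lerD2l.
have le1 (z : C) : z + z^*%R <= `|z| *+ 2.
  rewrite -mulr_natr -ler_pdivrMr ?ltr0n // -ReE.
  exact: le_trans (real_ler_norm (Creal_Re z)) (leif_normC_Re_Creal z).1.
by apply: le_trans (le1 (f u v)) _; rewrite lerMn2r dot_CauchySchwarz.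
Qed.
End dot_norm.

Lemma cauchy_seq_complete (R : realType) (V : normedModType R[i]) :
  (forall u : nat -> V,
    (forall e : R, 0 < e -> exists N, forall m n, (N <= m)%N -> (N <= n)%N ->
       `|u m - u n| <= e%:C) ->
    exists l, forall e : R, 0 < e -> exists N, forall n, (N <= n)%N ->
       `|l - u n| <= e%:C) ->
  forall F : set_system V, ProperFilter F -> cauchy F -> cvg F.
Proof.
move=> cplV F FF /cauchyP Fc.
have inv0 (n : nat) : 0 < (n.+1%:R^-1 : R)%:C.
  by rewrite ltcR invr_gt0 ltr0n.
pose u n := xget 0 [set x | F (ball x (n.+1%:R^-1 : R)%:C)].
have uF n : F (ball (u n) (n.+1%:R^-1 : R)%:C).
  have [x xF] := Fc _ (inv0 n).
  by rewrite /u; case: xgetP => [y _ //|/(_ x)]; move/(_ xF).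
have small (e : R) : 0 < e -> exists N, forall n, (N <= n)%N -> (n.+1%:R^-1 : R) <= e.
  move=> e0; exists (Num.bound e^-1) => n Nn.
  rewrite invf_ple ?posrE ?ltr0n //.
  apply: ltW; apply: lt_le_trans (archi_boundP _) _; first by rewrite invr_ge0 ltW.
  by rewrite ler_nat ltnW.
have [|l ul] := cplV u.
  move=> e e0; have [N HN] := small (e / 2) (divr_gt0 e0 (ltr0Sn _ 1)).
  exists N => m n Nm Nn.
  have [x [xm xn]] : exists x, ball (u m) (m.+1%:R^-1 : R)%:C x /\
      ball (u n) (n.+1%:R^-1 : R)%:C x.
    by have [x ?] := filter_ex (filterI (uF m) (uF n)); exists x.
  rewrite -!ball_normE /= in xm xn.
  rewrite -(subrK x (u m)) -addrA.
  apply: le_trans (ler_normD _ _) _.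
  rewrite (distrC x).
  apply: le_trans (lerD (ltW xm) (ltW xn)) _.
  by rewrite -rmorphD lecR [leRHS]splitr lerD ?HN.
apply/cvg_ex; exists l; apply/cvgrPdist_le => e e0.
have eE : e = (complex.Re e)%:C by have := ger0_Im (ltW e0); case: (e) => ? ? /= ->.
have e0' : 0 < complex.Re e by rewrite -ltcR -eE.
have [N1 HN1] := ul _ (divr_gt0 e0' (ltr0Sn _ 1)).
have [N2 HN2] := small _ (divr_gt0 e0' (ltr0Sn _ 1)).
pose n := maxn N1 N2.
apply: filterS (uF n) => x; rewrite -ball_normE /= => xn.
rewrite -(subrK (u n) l) -addrA.
apply: le_trans (ler_normD _ _) _.
apply: le_trans (lerD (HN1 _ (leq_maxl _ _)) (ltW xn)) _.
rewrite -rmorphD eE lecR [leRHS]splitr lerD2l.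
by apply: HN2; exact: leq_maxr.
Qed.

Lemma cvg_complex (R : realType) (u : nat -> R[i]^o) (a b : R) :
  (fun n => complex.Re (u n)) @ \oo --> a ->
  (fun n => complex.Im (u n)) @ \oo --> b ->
  u @ \oo --> (a +i* b : R[i]^o).
Proof.
move=> ua ub; apply/cvgrPdist_le => e e0.
have eE : e = (complex.Re e)%:C by have := ger0_Im (ltW e0); case: (e) => ? ? /= ->.
have e0' : 0 < complex.Re e / 2 by rewrite divr_gt0 // -ltcR -eE.
move/cvgrPdist_le : ua => /(_ _ e0') ua.
move/cvgrPdist_le : ub => /(_ _ e0') ub.
near=> n.
have -> : (a +i* b : R[i]^o) - u n = (a - complex.Re (u n))%:C + 'i%C * (b - complex.Im (u n))%:C :> R[i].
  by rewrite (complexE (_ - _)); case: (u n).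
apply: le_trans (ler_normD _ _) _.
rewrite normrM eE [X in _ <= X%:C]splitr [X in _ <= X]rmorphD.
have -> : `|'i%C| = 1 :> R[i] by rewrite normc_def /= expr0n add0r expr1n sqrtr1.
have nC (x : R) : `|x%:C| = `|x|%:C by rewrite normc_def /= expr0n addr0 sqrtr_sqr.
rewrite mul1r !nC; apply: lerD; rewrite lecR.
  by near: n.
by near: n.
Unshelve. all: by end_near. Qed.

Section rnorm_theory.
Context {R : realType}.

Lemma rnormZ (V : normedModType R[i]) (a : R[i]) (x : V) :
  rnorm (a *: x) = rnorm a * rnorm x.
Proof.
by apply/(@complexI R); rewrite rmorphM /= -!rnormE normrZ.
Qed.

Lemma rnormM (a b : R[i]) : rnorm (a * b) = rnorm a * rnorm b.
Proof. by apply/(@complexI R); rewrite rmorphM /= -!rnormE normrM. Qed.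

Lemma rnorm_conj (a : R[i]) : rnorm (a^*%R) = rnorm a.
Proof. by rewrite /rnorm norm_conjC. Qed.

Lemma rnormD (V : normedZmodType R[i]) (x y : V) :
  rnorm (x + y) <= rnorm x + rnorm y.
Proof. by rewrite -lecR rmorphD /= -!rnormE ler_normD. Qed.

Lemma rnormD2 (V : normedZmodType R[i]) (x y : V) :
  rnorm (x + y) ^+ 2 <= 2 * rnorm x ^+ 2 + 2 * rnorm y ^+ 2.
Proof.
apply: (@le_trans _ _ ((rnorm x + rnorm y) ^+ 2)).
  by rewrite lerXn2r ?nnegrE ?addr_ge0 ?rnorm_ge0 ?rnormD.
rewrite -subr_ge0 (_ : _ - _ = (rnorm x - rnorm y) ^+ 2) ?sqr_ge0 //.
by rewrite sqrrD sqrrB !mulr2n !mulrDl !mul1r; ring.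
Qed.

Lemma Re_rnorm (z : R[i]) : `|complex.Re z| <= rnorm z.
Proof. by rewrite -lecR -rnormE normc_ge_Re. Qed.

Lemma Im_rnorm (z : R[i]) : `|complex.Im z| <= rnorm z.
Proof.
have := Re_rnorm (z * 'i%C); rewrite ReiNIm normrN rnormM.
suff -> : rnorm ('i%C : R[i]) = 1 by rewrite mulr1.
by rewrite /rnorm normc_def /= expr0n add0r expr1n sqrtr1.
Qed.

Lemma rnorm2_Re (z : R[i]) : rnorm z ^+ 2 = complex.Re (z * z^*%R).
Proof. by rewrite -normCK rnormE -rmorphXn. Qed.

End rnorm_theory.

Section ell2.
Variable R : realType.

(* Sequences indexed by {1, 2, ...} are represented by functions on nat, with
   the index shifted by one. *)
Definition square_summable : {pred nat -> R[i]} :=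
  fun w => `[< cvgn (series (fun k => rnorm (w k) ^+ 2)) >].

Lemma square_summableP (w : nat -> R[i]) :
  reflect (cvgn (series (fun k => rnorm (w k) ^+ 2))) (w \in square_summable).
Proof. exact: asboolP. Qed.

Fact square_summable_submod : submod_closed square_summable.
Proof.
split=> [|a f g /square_summableP cf /square_summableP cg].
  apply/square_summableP; rewrite (_ : series _ = cst 0); first exact: is_cvg_cst.
  apply/funext => n; rewrite /series /= big1 // => k _.
  by rewrite /rnorm normr0 expr0n.
apply/square_summableP.
apply: (series_le_cvg (v_ := fun k =>
    2 * rnorm a ^+ 2 * rnorm (f k) ^+ 2 + 2 * rnorm (g k) ^+ 2)).
- by move=> n; exact: sqr_ge0.
- by move=> n; rewrite addr_ge0 // !mulr_ge0 ?rnorm_ge0 ?exprn_ge0 ?rnorm_ge0.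
- move=> n; apply: le_trans (rnormD2 _ _) _.
  have -> : rnorm ((a *: f) n) = rnorm a * rnorm (f n) by exact: rnormM.
  by rewrite exprMn mulrA.
- by apply: (@is_cvg_seriesD R (_ *: _) (_ *: _)); exact: is_cvg_seriesZ.
Qed.

HB.instance Definition _ := GRing.isSubmodClosed.Build R[i] (nat -> R[i])
  square_summable square_summable_submod.

Record ell2 := Ell2 {
  ell2_seq :> nat -> R[i];
  _ : ell2_seq \in square_summable }.

HB.instance Definition _ := [isSub for ell2_seq].
HB.instance Definition _ := [Choice of ell2 by <:].
HB.instance Definition _ := [SubChoice_isSubLmodule of ell2 by <:].

Lemma ell2_cvg (w : ell2) : cvgn (series (fun k => rnorm (w k) ^+ 2)).
Proof. by case: w => w /= /square_summableP. Qed.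

Definition ell2_inner (w v : ell2) : R[i] :=
  limn (series (fun k => w k * (v k)^*%R : R[i]^o)).

Let sq (w : nat -> R[i]) (k : nat) : R := rnorm (w k) ^+ 2.

Lemma Re_series (u : nat -> R[i]) n :
  complex.Re (series u n) = series (fun k => complex.Re (u k)) n.
Proof. by apply: (big_morph (@complex.Re R)) => // [] [? ?] [? ?]. Qed.

Lemma Im_series (u : nat -> R[i]) n :
  complex.Im (series u n) = series (fun k => complex.Im (u k)) n.
Proof. by apply: (big_morph (@complex.Im R)) => // [] [? ?] [? ?]. Qed.

Lemma rnorm_series_cvg (u : nat -> R[i]) :
  cvgn (series (fun k => rnorm (u k))) -> cvgn (series (u : nat -> R[i]^o)).
Proof.
move=> cu.
have cRe : cvgn (series (fun k => complex.Re (u k))).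
  apply: normed_cvg; apply: series_le_cvg cu => n //=; first exact: rnorm_ge0.
  exact: Re_rnorm.
have cIm : cvgn (series (fun k => complex.Im (u k))).
  apply: normed_cvg; apply: series_le_cvg cu => n //=; first exact: rnorm_ge0.
  exact: Im_rnorm.
apply: cvgP; apply: cvg_complex.
  under eq_fun do rewrite Re_series; exact: cRe.
under eq_fun do rewrite Im_series; exact: cIm.
Qed.

Lemma ell2_inner_cvg (w v : ell2) :
  series (fun k => w k * (v k)^*%R : R[i]^o) @ \oo --> (ell2_inner w v : R[i]^o).
Proof.
apply: rnorm_series_cvg.
apply: (series_le_cvg (v_ := fun k => sq w k + sq v k)).
- by move=> n; exact: rnorm_ge0.
- by move=> n; rewrite addr_ge0 ?sqr_ge0.
- move=> n; rewrite rnormM rnorm_conj /sq.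
  have := sqr_ge0 (rnorm (w n) - rnorm (v n)).
  have := rnorm_ge0 (w n); have := rnorm_ge0 (v n); nra.
- by apply: (@is_cvg_seriesD R (sq w) (sq v)); exact: ell2_cvg.
Qed.

Fact ell2_inner_bilinear :
  bilinear_for *%R (Num.conj_op \; *%R) ell2_inner.
Proof.
have lin1 u a x y : ell2_inner (a *: x + y) u = a * ell2_inner x u + ell2_inner y u.
  apply: (@cvg_lim R[i]^o); first exact: norm_hausdorff.
  rewrite (_ : series _ = a \*: series (fun k => x k * (u k)^*%R : R[i]^o) \+
    series (fun k => y k * (u k)^*%R : R[i]^o)).
    exact: cvgD (cvgZl_tmp (k := a) (@ell2_inner_cvg x u)) (@ell2_inner_cvg y u).
  apply/funext => n; rewrite /series /= scaler_sumr -big_split /=; apply: eq_bigr => k _.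
  by rewrite mulrDl -mulrA.
split=> u a x y; first exact: lin1.
apply: (@cvg_lim R[i]^o); first exact: norm_hausdorff.
rewrite (_ : series _ = a^*%R \*: series (fun k => u k * (x k)^*%R : R[i]^o) \+
  series (fun k => u k * (y k)^*%R : R[i]^o)).
  exact: cvgD (cvgZl_tmp (k := a^*%R) (@ell2_inner_cvg u x)) (@ell2_inner_cvg u y).
apply/funext => n; rewrite /series /= scaler_sumr -big_split /=; apply: eq_bigr => k _.
by rewrite rmorphD rmorphM mulrDr mulrCA.
Qed.

HB.instance Definition _ := bilinear_isBilinear.Build
  R[i] ell2 ell2 R[i] *%R (Num.conj_op \; *%R)
  ell2_inner ell2_inner_bilinear.

Fact ell2_inner_hermitian (w v : ell2) :
  ell2_inner w v = (-1) ^+ false * (ell2_inner v w)^*%R.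
Proof.
rewrite expr0 mul1r; apply: (@cvg_lim R[i]^o); first exact: norm_hausdorff.
apply/cvgrPdist_le => e e0.
have /cvgrPdist_le/(_ _ e0) := @ell2_inner_cvg v w.
apply: filterS => n; apply: le_trans.
rewrite (_ : _ - _ = Num.conj_op (ell2_inner v w -
  series (fun k => v k * (w k)^*%R) n) :> R[i]); first by rewrite -[leLHS]/(`|_ : R[i]|) norm_conjC.
rewrite rmorphB /series rmorph_sum /=; congr (_ - _); apply: eq_bigr => k _.
by rewrite rmorphM /= conjCK mulrC.
Qed.

HB.instance Definition _ := isHermitianSesquilinear.Build
  R[i] ell2 false Num.conj_op ell2_inner ell2_inner_hermitian.

Lemma ell2_innerE (w : ell2) : ell2_inner w w = (limn (series (sq w)))%:C.
Proof.
apply: (@cvg_lim R[i]^o); first exact: norm_hausdorff.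
apply: cvg_complex.
  under eq_fun do rewrite Re_series.
  under eq_fun do under eq_fun do rewrite -rnorm2_Re.
  exact: ell2_cvg.
under eq_fun do rewrite Im_series.
rewrite (_ : (fun n => _) = cst 0); first exact: cvg_cst.
apply/funext => n; rewrite /series /= big1 // => k _.
by rewrite -normCK rnormE -rmorphXn.
Qed.

Lemma ell2_sq_le (w : ell2) n : series (sq w) n <= limn (series (sq w)).
Proof.
apply: nondecreasing_cvgn_le; last exact: ell2_cvg.
by apply: nondecreasing_series => k _ _; exact: sqr_ge0.
Qed.

Fact ell2_inner_gt0 (w : ell2) : w != 0 -> 0 < ell2_inner w w.
Proof.
move=> w0; rewrite ell2_innerE ltcR.
have [k wk] : exists k, w k != 0.
  apply: contrapT => /forallNP h; move/eqP: w0; apply; apply/val_inj/funext => k /=.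
  by have /negP := h k; rewrite negbK => /eqP.
apply: lt_le_trans (ell2_sq_le w k.+1).
rewrite /series /= big_nat_recr //= ltr_wpDl ?sumr_ge0 // => [i _|].
  exact: sqr_ge0.
by rewrite exprn_gt0 // -ltcR -rnormE normr_gt0.
Qed.

HB.instance Definition _ := isDotProduct.Build
  R[i] ell2 ell2_inner ell2_inner_gt0.
HB.instance Definition _ := hasInner.Build R ell2 ell2_inner.

Let nm (w : ell2) : R[i] := sqrtC (inner w w).

Fact ell2_normZ a w : nm (a *: w) = `|a| * nm w.
Proof.
by rewrite /nm dnormZ sqrtCM ?nnegrE ?exprn_ge0 ?dnorm_ge0 // sqrCK.
Qed.

Fact ell2_norm0_eq0 w : nm w = 0 -> w = 0.
Proof. by move/eqP; rewrite sqrtC_eq0 dnorm_eq0 => /eqP. Qed.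

HB.instance Definition _ := Lmodule_isNormed.Build R[i] ell2
  (dot_triangle (@inner R ell2)) ell2_normZ ell2_norm0_eq0.

Lemma ell2_normE (w : ell2) : `|w| ^+ 2 = inner w w.
Proof. by rewrite -[LHS]/(nm w ^+ 2) sqrtCK. Qed.

Lemma ell2_rnormE (w : ell2) : rnorm w ^+ 2 = limn (series (sq w)).
Proof.
by apply/(@complexI R); rewrite rmorphXn /= -rnormE ell2_normE -ell2_innerE.
Qed.

Lemma ell2_sum_le (w : ell2) n :
  series (fun k => rnorm (w k) ^+ 2) n <= rnorm w ^+ 2.
Proof. by rewrite ell2_rnormE; exact: ell2_sq_le. Qed.

Lemma ell2_coord_le (w : ell2) k : rnorm (w k) <= rnorm w.
Proof.
rewrite -ler_sqr ?nnegrE ?rnorm_ge0 //.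
apply: le_trans (ell2_sum_le w k.+1).
by rewrite /series /= big_nat_recr //= lerDr sumr_ge0 // => i _; exact: sqr_ge0.
Qed.

Lemma rnorm2_ReIm (z : R[i]) :
  rnorm z ^+ 2 = complex.Re z ^+ 2 + complex.Im z ^+ 2.
Proof. by case: z => a b; rewrite rnorm2_Re /= mulrN opprK -!expr2. Qed.

Lemma real_cauchy (a : nat -> R) :
  (forall e, 0 < e -> exists N, forall m n, (N <= m)%N -> (N <= n)%N ->
     `|a m - a n| <= e) -> cvgn a.
Proof.
move=> ca; apply/cauchy_cvgP/cauchy_exP => e e0.
have [N HN] := ca _ (divr_gt0 e0 (ltr0Sn _ 1)).
exists (a N); suff : \forall n \near \oo, ball (a N) e (a n) by [].
near=> n; rewrite -ball_normE /=.
apply: le_lt_trans (HN N n _ _) _ => //; first by near: n; exact: nbhs_infty_ge.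
by rewrite ltr_pdivrMr // ltr_pMr // ltr1n.
Unshelve. all: by end_near. Qed.

Let ell2B (w v : ell2) k : (w - v) k = w k - v k.
Proof. by []. Qed.

Let ReB (z t : R[i]) : complex.Re (z - t) = complex.Re z - complex.Re t.
Proof. by case: z t => [? ?] []. Qed.

Let ImB (z t : R[i]) : complex.Im (z - t) = complex.Im z - complex.Im t.
Proof. by case: z t => [? ?] []. Qed.

Fact ell2_seq_complete (u : nat -> ell2) :
  (forall e : R, 0 < e -> exists N, forall m n, (N <= m)%N -> (N <= n)%N ->
     `|u m - u n| <= e%:C) ->
  exists l, forall e : R, 0 < e -> exists N, forall n, (N <= n)%N ->
     `|l - u n| <= e%:C.
Proof.
move=> cu.
have cRe k : cvgn (fun n => complex.Re (u n k)).
  apply: real_cauchy => e /cu[N HN]; exists N => m n Nm Nn.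
  have := HN _ _ Nm Nn; rewrite rnormE lecR; apply: le_trans.
  apply: le_trans (ell2_coord_le _ k); apply: le_trans (Re_rnorm _).
  by rewrite ell2B ReB.
have cIm k : cvgn (fun n => complex.Im (u n k)).
  apply: real_cauchy => e /cu[N HN]; exists N => m n Nm Nn.
  have := HN _ _ Nm Nn; rewrite rnormE lecR; apply: le_trans.
  apply: le_trans (ell2_coord_le _ k); apply: le_trans (Im_rnorm _).
  by rewrite ell2B ImB.
pose v k : R[i] := limn (fun n => complex.Re (u n k)) +i* limn (fun n => complex.Im (u n k)).
have bound e N n : 0 < e -> (forall m n, (N <= m)%N -> (N <= n)%N -> `|u m - u n| <= e%:C) ->
    (N <= n)%N -> forall K, series (sq (fun k => v k - u n k)) K <= e ^+ 2.
  move=> e0 HN Nn K.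
  have cK : series (sq (fun k => u m k - u n k)) K @[m --> \oo] -->
      series (sq (fun k => v k - u n k)) K.
    elim: K => [|K IH].
      by under eq_fun do rewrite /series /= big_geq //; rewrite /series /= big_geq //; exact: cvg_cst.
    rewrite [X in _ --> X](_ : _ = series (sq (fun k => v k - u n k)) K +
      ((complex.Re (v K) - complex.Re (u n K)) ^+ 2 +
       (complex.Im (v K) - complex.Im (u n K)) ^+ 2)); last first.
      by rewrite /series /= big_nat_recr //= {2}/sq rnorm2_ReIm ReB ImB.
    rewrite (_ : (fun m => _) = (fun m => series (sq (fun k => u m k - u n k)) K +
      ((complex.Re (u m K) - complex.Re (u n K)) ^+ 2 +
       (complex.Im (u m K) - complex.Im (u n K)) ^+ 2))); last first.
      apply/funext => m; by rewrite /series /= big_nat_recr //= {2}/sq rnorm2_ReIm ReB ImB.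
    apply: cvgD => //; apply: cvgD; under eq_fun do rewrite expr2; rewrite expr2;
      apply: cvgM; apply: cvgB; (exact: cvg_cst || exact: cRe || exact: cIm).
  rewrite -(cvg_lim (@Rhausdorff R) cK).
  apply: limr_le; first by apply: cvgP cK.
  near=> m; apply: le_trans (ell2_sum_le (u m - u n) K) _.
  have le_e : rnorm (u m - u n) <= e.
    by rewrite -lecR -rnormE HN //; near: m; exact: nbhs_infty_ge.
  by rewrite lerXn2r ?nnegrE ?rnorm_ge0 // ltW.
have vs n e N : 0 < e -> (forall m n, (N <= m)%N -> (N <= n)%N -> `|u m - u n| <= e%:C) ->
    (N <= n)%N -> (fun k => v k - u n k) \in square_summable.
  move=> e0 HN Nn; apply/square_summableP.
  apply: nondecreasing_is_cvgn; first by apply: nondecreasing_series => ? _ _; exact: sqr_ge0.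
  by exists (e ^+ 2) => _ [K _ <-]; exact: (bound _ N).
have [N1 HN1] := cu _ ltr01.
have vE : v \in square_summable.
  have -> : v = (fun k => v k - u N1 k) + (u N1 : nat -> R[i]).
    by apply/funext => k; rewrite -[RHS]/(_ - _ + _) subrK.
  by apply: rpredD; [exact: (vs _ _ _ ltr01 HN1) | exact: valP].
exists (Ell2 vE) => e e0; have [N HN] := cu _ e0.
exists N => n Nn; rewrite rnormE lecR -ler_sqr ?nnegrE ?rnorm_ge0 ?(ltW e0) //.
rewrite ell2_rnormE; apply: limr_le; first exact: ell2_cvg.
by near=> K; exact: (bound _ N).
Unshelve. all: by end_near. Qed.

HB.instance Definition _ := Uniform_isComplete.Build ell2
  (cauchy_seq_complete ell2_seq_complete).
HB.instance Definition _ := InnerNormed_isHilbert.Build R ell2 ell2_normE.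
End ell2.

Section hilbert_theory.
Variables (R : realType) (H : hilbertType R).
Implicit Types x y z h : H.

Lemma innerE x : inner x x = (rnorm x ^+ 2)%:C.
Proof. by rewrite -normr_inner rnormE -rmorphXn. Qed.

Lemma rnormD_sq x y :
  rnorm (x + y) ^+ 2 = rnorm x ^+ 2 + rnorm y ^+ 2 + 2 * complex.Re (inner x y).
Proof.
apply/(@complexI R); rewrite -innerE dnormD !innerE !rmorphD /=.
congr (_ + _).
case: (inner x y) => a b.
by apply/eqP; rewrite eq_complex /=; apply/andP; split; apply/eqP; ring.
Qed.

Lemma rnorm_inner_le x y : rnorm (inner x y) <= rnorm x * rnorm y.
Proof.
have := dot_CauchySchwarz inner x y; rewrite -!normr_inner !sqrCK ?normr_ge0 //.
by rewrite !rnormE -rmorphM lecR.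
Qed.

Lemma hilbert_cauchy (u : nat -> H) :
  (forall e : R, 0 < e -> exists N, forall m n, (N <= m)%N -> (N <= n)%N ->
     rnorm (u m - u n) <= e) ->
  exists l, forall e : R, 0 < e -> exists N, forall n, (N <= n)%N ->
     rnorm (l - u n) <= e.
Proof.
move=> cu.
have /cvg_ex[l ul] : cvgn u.
  apply/cauchy_cvgP/cauchy_exP => e e0.
  have eE : e = (complex.Re e)%:C.
    by have := ger0_Im (ltW e0); case: (e) => ? ? /= ->.
  have e0' : 0 < complex.Re e by rewrite -ltcR -eE.
  have [N HN] := cu _ (divr_gt0 e0' (ltr0Sn _ 1)).
  exists (u N); suff : \forall n \near \oo, ball (u N) e (u n) by [].
  near=> n; rewrite -ball_normE /= rnormE eE ltcR.
  apply: (@le_lt_trans _ _ (complex.Re e / 2)).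
    by apply: HN => //; near: n; exact: nbhs_infty_ge.
  by rewrite ltr_pdivrMr // ltr_pMr // ltr1n.
exists l => e e0.
have e0' : 0 < e%:C by rewrite ltcR.
move/cvgrPdist_le : ul => /(_ _ e0')[N _ HN].
by exists N => n Nn; rewrite -lecR -rnormE; exact: HN.
Unshelve. all: by end_near. Qed.

Theorem riesz (f : H -> R[i]) (C : R) :
  scalar f -> (forall x, rnorm (f x) <= C * rnorm x) ->
  exists z, forall x, f x = inner x z.
Proof.
move=> lf bf.
have fD x y : f (x + y) = f x + f y by have := lf 1 x y; rewrite scale1r mul1r.
have f0 : f 0 = 0.
  by apply: (addrI (f 0)); rewrite addr0 -fD addr0.
have fZ a x : f (a *: x) = a * f x by have := lf a x 0; rewrite addr0 f0 addr0.
pose J x : R := rnorm x ^+ 2 - 2 * complex.Re (f x).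
have Jlb x : - C ^+ 2 <= J x.
  have := le_trans (ler_norm _) (le_trans (Re_rnorm (f x)) (bf x)).
  have := sqr_ge0 (rnorm x - C); rewrite /J; nra.
have hJ : has_inf [set J x | x in setT].
  by split; [exists (J 0), 0 | exists (- C ^+ 2) => _ [x _ <-]].
pose m := inf [set J x | x in setT].
have mJ x : m <= J x by apply: ge_inf; [exact: hJ.2 | exists x].
have Jm e : 0 < e -> exists x, J x < m + e.
  by move=> e0; have [_ [x _ <-] xe] := inf_adherent e0 hJ; exists x.
have inv0 n : 0 < n.+1%:R^-1 :> R by rewrite invr_gt0 ltr0n.
have [u uE] : exists u : nat -> H, forall n, J (u n) < m + n.+1%:R^-1.
  by have /choice[u uE] := fun n => Jm _ (inv0 n); exists u.
have ReD a b : complex.Re (a + b) = complex.Re a + complex.Re b :> R.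
  by case: a b => [? ?] [].
have JD x h (t : R) : J (x + t%:C *: h) =
    J x + 2 * t * complex.Re (inner x h - f h) + t ^+ 2 * rnorm h ^+ 2.
  rewrite /J rnormD_sq fD fZ linearZr_LR /= ReD.
  rewrite rnormZ exprMn [rnorm t%:C]/rnorm normc_def /= expr0n addr0 sqrtr_sqr.
  rewrite real_normK ?num_real //.
  by case: (inner x h) (f h) => [a b] [c d] /=; ring.
have JB x y : rnorm (x - y) ^+ 2 =
    2 * J x + 2 * J y - 4 * J (2^-1%:C *: (x + y)).
  rewrite /J fZ fD rnormZ exprMn !rnormD_sq linearNr /=.
  have -> : rnorm (- y) = rnorm y by rewrite /rnorm normrN.
  rewrite [rnorm _%:C]/rnorm normc_def /= expr0n addr0 sqrtr_sqr real_normK ?num_real //.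
  case: (inner x y) (f x) (f y) => [a b] [c d] [e g] /=; by field.
have [z uz] : exists l, forall e : R, 0 < e -> exists N, forall n, (N <= n)%N ->
     rnorm (l - u n) <= e.
  apply: hilbert_cauchy => e e0.
  pose d := e ^+ 2 / 4.
  have d0 : 0 < d by rewrite divr_gt0 // exprn_gt0.
  exists (Num.bound d^-1) => p q Np Nq.
  have small n : (Num.bound d^-1 <= n)%N -> n.+1%:R^-1 <= d.
    move=> Nn; rewrite invf_ple ?posrE ?ltr0n //; apply: ltW.
    apply: lt_le_trans (archi_boundP _) _; first by rewrite invr_ge0 ltW.
    by rewrite ler_nat ltnW.
  rewrite -ler_sqr ?nnegrE ?rnorm_ge0 ?(ltW e0) // JB.
  have := mJ (2^-1%:C *: (u p + u q)).
  have := uE p; have := uE q; have := small _ Np; have := small _ Nq.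
  have dE : e ^+ 2 = 4 * d by rewrite /d; field.
  rewrite dE; clearbody d; clear -d; move: (J (_ *: _)) (J (u p)) (J (u q)) (_^-1) (_^-1) => j1 j2 j3 i1 i2; lra.
have key h : complex.Re (inner z h - f h) = 0.
  apply/eqP; rewrite -normr_le0; apply/ler_addgt0Pr => e e0; rewrite add0r.
  pose k := rnorm h + 1.
  have k0 : 0 < k by rewrite ltr_wpDl ?rnorm_ge0.
  have hk : rnorm h <= k by rewrite lerDl.
  have e2 : 0 < e / 2 / k by rewrite !divr_gt0.
  have [N HN] := uz _ e2.
  pose d := (e / 2 / k) ^+ 2.
  have d0 : 0 < d by rewrite exprn_gt0.
  pose n := maxn N (Num.bound d^-1).
  have nd : n.+1%:R^-1 <= d.
    rewrite invf_ple ?posrE ?ltr0n //; apply: ltW.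
    apply: lt_le_trans (archi_boundP _) _; first by rewrite invr_ge0 ltW.
    by rewrite ler_nat ltnW // ltnS leq_maxr.
  set D := complex.Re _.
  pose Dn := complex.Re (inner (u n) h - f h).
  have Dn_le : `|Dn| <= e / 2.
    pose t : R := - Dn / k ^+ 2.
    have := mJ (u n + t%:C *: h); rewrite JD -/Dn => mt.
    have := uE n => un.
    have h2 : rnorm h ^+ 2 <= k ^+ 2 by rewrite lerXn2r ?nnegrE ?rnorm_ge0 // ltW.
    have th : t ^+ 2 * rnorm h ^+ 2 <= t ^+ 2 * k ^+ 2 by rewrite ler_wpM2l ?sqr_ge0.
    have k2 : 0 < k ^+ 2 by rewrite exprn_gt0.
    have tE : 2 * t * Dn + t ^+ 2 * k ^+ 2 = - (Dn ^+ 2 / k ^+ 2).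
      by rewrite /t; field; rewrite gt_eqF.
    have Dd : Dn ^+ 2 / k ^+ 2 <= d.
      move: tE th un mt nd; move: (Dn ^+ 2 / _) (2 * t * Dn) (t ^+ 2 * k ^+ 2).
      move: (t ^+ 2 * rnorm h ^+ 2) (J (u n)) (n.+1%:R^-1) => a1 a2 a3 a4 a5 a6.
      clearbody d m; lra.
    rewrite -ler_sqr ?nnegrE ?normr_ge0 ?divr_ge0 ?(ltW e0) // real_normK ?num_real //.
    move: Dd; rewrite /d ler_pdivrMr // => /le_trans; apply.
    by rewrite -exprMn divfK // gt_eqF.
  have DDn : `|D - Dn| <= e / 2.
    have -> : D - Dn = complex.Re (inner (z - u n) h).
      rewrite /D /Dn linearBl /=.
      by case: (inner z h) (inner (u n) h) (f h) => [? ?] [? ?] [? ?] /=; ring.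
    apply: le_trans (Re_rnorm _) _; apply: le_trans (rnorm_inner_le _ _) _.
    apply: (@le_trans _ _ (e / 2 / k * k)); last by rewrite divfK // gt_eqF.
    by apply: ler_pM; rewrite ?rnorm_ge0 // HN // leq_maxl.
  rewrite -(subrK Dn D) [leRHS]splitr.
  by apply: le_trans (ler_normD _ _) _; exact: lerD.
exists z => x.
have k1 := key x; have k2 := key ('i%C *: x).
have -> : inner x z = (inner z x)^*%R by rewrite hermC expr0 mul1r.
move: k1 k2; rewrite fZ linearZr_LR /=.
case: (inner z x) (f x) => [a b] [c d] /=.
rewrite !mul0r !mul1r !sub0r ?opprK ?add0r => /eqP; rewrite subr_eq0 => /eqP <-.
move=> h; apply/eqP; rewrite eq_complex /= eqxx /=; apply/eqP; lra.
Qed.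
End hilbert_theory.

Section operators.
Context {R : realType}.

(* The set L(X, Y). *)
Definition bounded_op (X Y : normedModType R[i]) : set (X -> Y) :=
  [set T | linear T /\ exists C : R, forall x, rnorm (T x) <= C * rnorm x].

(* Only meaningful for bounded T: the sup of an unbounded set is 0. *)
Definition opnorm (X Y : normedModType R[i]) (T : X -> Y) : R :=
  sup [set rnorm (T x) | x in [set x | rnorm x <= 1]].

(* The S such that <T x, y> = <x, S y>; it is unique when it exists, and it
   exists for bounded T on Hilbert spaces by adjointP. *)
Definition adjoint (X Y : innerProductType R) (T : X -> Y) : Y -> X :=
  xget (cst 0) [set S | forall x y, inner (T x) y = inner x (S y)].

Lemma adjointP (X Y : hilbertType R) (T : X -> Y) :
  bounded_op T -> forall x y, inner (T x) y = inner x (adjoint T y).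
Proof.
move=> [lT [C bT]]; rewrite /adjoint; case: xgetP => [S _ //|noS].
have /choice[S HS] y : exists z, forall x, inner (T x) y = inner x z.
  apply: (@riesz _ _ _ (rnorm y * C)) => [a u v|x].
    by rewrite lT linearPl.
  apply: le_trans (rnorm_inner_le _ _) _.
  by rewrite mulrC -mulrA ler_wpM2l ?rnorm_ge0.
by exfalso; apply: (noS S) => x y; exact: HS.
Qed.

(* In the order of R[i], 0 <= z means that z is real and nonnegative. *)
Definition op_le (X : innerProductType R) (S T : X -> X) : Prop :=
  forall x, 0 <= inner (T x - S x) x.

(* Block operators: the column [S; T] and the row [S T]. *)
Definition col_op (Z X U : lmodType R[i]) (S : Z -> X) (T : Z -> U) : Z -> X * U :=
  fun z => (S z, T z).

Definition row_op (X U Z : lmodType R[i]) (S : X -> Z) (T : U -> Z) : X * U -> Z :=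
  fun p => S p.1 + T p.2.

Definition bessel (Y : hilbertType R) (eta : nat -> Y) : Prop :=
  exists2 alpha : R, 0 < alpha & forall y,
    (\sum_(0 <= k <oo) (rnorm (inner y (eta k)) ^+ 2)%:E <=
     (alpha * rnorm y ^+ 2)%:E)%E.

Definition frame (Y : hilbertType R) (eta : nat -> Y) : Prop :=
  exists alpha beta : R, [/\ 0 < alpha, 0 < beta & forall y,
    ((beta * rnorm y ^+ 2)%:E <=
       \sum_(0 <= k <oo) (rnorm (inner y (eta k)) ^+ 2)%:E <=
     (alpha * rnorm y ^+ 2)%:E)%E].

(* For a Bessel sequence, the series converges and defines a bounded operator:
   see synthesis_cvg and synthesis_bounded. *)
Definition synthesis (Y : hilbertType R) (eta : nat -> Y) : ell2 R -> Y :=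
  fun w => limn (series (fun k => w k *: eta k)).

Section data.
Variables X U : hilbertType R.
Variables (x1 x0 : nat -> X) (u0 : nat -> U).

(* x1, x0, u0 are the noisy data; c1 and c0 bound the noise relative to them. *)
Definition noise_class (c1 c0 : R) (Omega : X -> ell2 R) :
    set ((nat -> X) * (nat -> X) * (nat -> U)) :=
  [set d | let: (d1, d0, t0) := d in
    [/\ bessel d1, bessel d0 & bessel t0] /\
    op_le
      (synthesis d1 \o Omega \o adjoint Omega \o adjoint (synthesis d1))
      ((c1 ^+ 2)%:C \*:
        (synthesis x1 \o Omega \o adjoint Omega \o adjoint (synthesis x1))) /\
    op_le
      (col_op (synthesis d0) (synthesis t0) \o Omega \o adjoint Omega \o
        row_op (adjoint (synthesis d0)) (adjoint (synthesis t0)))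
      ((c0 ^+ 2)%:C \*:
        (col_op (synthesis x0) (synthesis u0) \o Omega \o adjoint Omega \o
          row_op (adjoint (synthesis x0)) (adjoint (synthesis u0))))].

Definition Sigma_is (c1 c0 : R) (Omega : X -> ell2 R) :
    set ((X -> X) * (U -> X)) :=
  [set AB | [/\ bounded_op AB.1, bounded_op AB.2 &
    exists d1 d0 t0, noise_class c1 c0 Omega (d1, d0, t0) /\
      forall k, x1 k - d1 k = AB.1 (x0 k - d0 k) + AB.2 (u0 k - t0 k)]].

Definition Sigma_stab (K : X -> U) (M gamma : R) : set ((X -> X) * (U -> X)) :=
  [set AB | [/\ bounded_op AB.1, bounded_op AB.2 &
    forall k, opnorm (iter k (AB.1 \+ (AB.2 \o K))) <= M * gamma ^+ k]].

Definition informative (gamma c1 c0 : R) (Omega : X -> ell2 R) : Prop :=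
  exists (K : X -> U) (M : R), [/\ bounded_op K, 1 <= M &
    Sigma_is c1 c0 Omega `<=` Sigma_stab K M gamma].
End data.
End operators.

Section synthesis_theory.
Variables (R : realType) (Y : hilbertType R) (eta : nat -> Y).
Hypothesis eta_bessel : bessel eta.

Let bessel_sum : exists2 alpha : R, 0 < alpha & forall y m n,
  \sum_(m <= k < n) rnorm (inner y (eta k)) ^+ 2 <= alpha * rnorm y ^+ 2.
Proof.
have [a a0 Ha] := eta_bessel; exists a => // y m n.
rewrite -lee_fin; apply: le_trans (Ha y).
apply: (@le_trans _ _ (\sum_(0 <= k < n) (rnorm (inner y (eta k)) ^+ 2)%:E)%E).
  rewrite sumEFin lee_fin; have [mn|nm] := leqP m n.
    rewrite [leRHS](big_cat_nat (n := m) _ mn) //= lerDr sumr_ge0 // => k _.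
    exact: sqr_ge0.
  by rewrite big_geq ?(ltnW nm) // sumr_ge0 // => k _; exact: sqr_ge0.
by apply: nneseries_lim_ge => k _ _; rewrite lee_fin sqr_ge0.
Qed.

Let synthesis_sum : exists2 alpha : R, 0 < alpha & forall (w : ell2 R) m n,
  rnorm (\sum_(m <= k < n) w k *: eta k) ^+ 2 <=
  alpha * \sum_(m <= k < n) rnorm (w k) ^+ 2.
Proof.
have [a a0 Ha] := bessel_sum; exists a => // w m n.
set v := \sum_(m <= k < n) _.
have vE : rnorm v ^+ 2 <=
    \sum_(m <= k < n) rnorm (w k) * rnorm (inner v (eta k)).
  have -> : rnorm v ^+ 2 = rnorm (inner v v).
    by rewrite innerE [RHS]/rnorm ger0_norm // ler0c sqr_ge0.
  rewrite {2}/v linear_sumr /= -lecR -rnormE (le_trans (ler_norm_sum _ _ _)) //.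
  rewrite rmorph_sum /=; apply: ler_sum => k _.
  by rewrite linearZr_LR /= normrM norm_conjC !rnormE rmorphM.
have le2 : \sum_(m <= k < n) rnorm (w k) * rnorm (inner v (eta k)) <=
    \sum_(m <= k < n) (a / 2 * rnorm (w k) ^+ 2 +
      (2 * a)^-1 * rnorm (inner v (eta k)) ^+ 2).
  apply: ler_sum => k _; move: (rnorm (w k)) (rnorm (inner _ _)) => p q.
  rewrite -subr_ge0 (_ : _ - _ = (2 * a)^-1 * (a * p - q) ^+ 2).
    by rewrite mulr_ge0 ?sqr_ge0 // invr_ge0 mulr_ge0 // ltW.
  by field; rewrite gt_eqF.
have := le_trans vE le2; rewrite big_split /= -!mulr_sumr.
have := Ha v m n.
move: (\sum_(m <= k < n) rnorm (w k) ^+ 2) (\sum_(m <= k < n) _) (rnorm v ^+ 2).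
move=> p q r qr; have : (2 * a)^-1 * q <= r / 2.
  by rewrite ler_pdivrMl ?mulr_gt0 //; lra.
lra.
Qed.

Lemma synthesis_cvg (w : ell2 R) :
  series (fun k => w k *: eta k) @ \oo --> synthesis eta w.
Proof.
have [a a0 Ha] := synthesis_sum.
pose s := series (fun k => rnorm (w k) ^+ 2).
suff [l Hl] : exists l, forall e : R, 0 < e -> exists N, forall n, (N <= n)%N ->
     rnorm (l - series (fun k => w k *: eta k) n) <= e.
  suff : cvgn (series (fun k => w k *: eta k)) by [].
  apply/cvg_ex; exists l; apply/cvgrPdist_le => e e0.
  have eE : e = (complex.Re e)%:C.
    by have := ger0_Im (ltW e0); case: (e) => ? ? /= ->.
  have e0' : 0 < complex.Re e by rewrite -ltcR -eE.
  have [N HN] := Hl _ e0'.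
  by exists N => // n Nn; rewrite rnormE eE lecR HN.
apply: hilbert_cauchy => e e0.
have d0 : 0 < e ^+ 2 / (2 * a) by rewrite divr_gt0 ?exprn_gt0 ?mulr_gt0.
have /cvgrPdist_le/(_ _ d0)[N _ HN] := @ell2_cvg R w.
have main m n : (N <= m)%N -> (m <= n)%N ->
    rnorm (series (fun k => w k *: eta k) n - series (fun k => w k *: eta k) m) <= e.
  move=> Nm mn; rewrite -ler_sqr ?nnegrE ?rnorm_ge0 ?(ltW e0) //.
  rewrite /series /= (big_cat_nat (n := m) _ mn) //= addrAC subrr add0r.
  apply: le_trans (Ha w m n) _.
  have -> : \sum_(m <= k < n) rnorm (w k) ^+ 2 = s n - s m.
    by rewrite /s /series /= [X in _ = X - _](big_cat_nat (n := m) _ mn) //= addrAC subrr add0r.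
  rewrite mulrC -ler_pdivlMr //.
  have := HN m Nm; have := HN n (leq_trans Nm mn); rewrite -/s /= => h1 h2.
  have dE : e ^+ 2 / a = e ^+ 2 / (2 * a) + e ^+ 2 / (2 * a).
    by field; rewrite gt_eqF.
  have := le_trans (ler_norm _) h2; rewrite distrC in h1.
  have := le_trans (ler_norm _) h1; rewrite dE; lra.
exists N => m n Nm Nn; have [mn|/ltnW nm] := leqP m n; last exact: main.
by rewrite /rnorm distrC; exact: main.
Qed.

Lemma synthesis_bounded : bounded_op (synthesis eta).
Proof.
have [a a0 Ha] := synthesis_sum; split.
  move=> c u v; apply: (@cvg_lim Y); first exact: norm_hausdorff.
  rewrite (_ : series _ = c \*: series (fun k => u k *: eta k) \+
    series (fun k => v k *: eta k)).
    exact: cvgD (cvgZl_tmp (k := c) (@synthesis_cvg u)) (@synthesis_cvg v).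
  apply/funext => n; rewrite /series /= scaler_sumr -big_split /=.
  by apply: eq_bigr => k _; rewrite scalerDl scalerA.
exists (Num.sqrt a) => w.
have b n : rnorm (series (fun k => w k *: eta k) n) <= Num.sqrt a * rnorm w.
  rewrite -ler_sqr ?nnegrE ?mulr_ge0 ?sqrtr_ge0 ?rnorm_ge0 //.
  rewrite exprMn sqr_sqrtr ?(ltW a0) //; apply: le_trans (Ha w 0 n) _.
  by rewrite ler_pM2l //; exact: ell2_sum_le.
apply/ler_addgt0Pr => e e0; have e0' : 0 < e%:C by rewrite ltcR.
have /cvgrPdist_le/(_ _ e0')[N _ HN] := @synthesis_cvg w.
have := HN N (leqnn N); rewrite /= rnormE lecR => le_e.
rewrite -(subrK (series (fun k => w k *: eta k) N) (synthesis eta w)) addrC.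
apply: le_trans (rnormD _ _) _; exact: lerD.
Qed.
End synthesis_theory.

(* Main.v *)
(* Write F = Xi1 Xi0d and G = A + B K. Composing the data equation with Xi0d
   gives G = F - D + E with D = Delta1 Xi0d and E = A Delta0 Xi0d + B Theta0 Xi0d,
   and the noise bounds become |D^* x| <= c1 |F^* x| and |E^* x| <= c0 |G^* x|;
   hence the whole estimate is made on the adjoints. In the equivalent norm
   N x = sup_k gamma^-k |F^*^k x|, which satisfies |x| <= N x <= M |x| and
   N (F^* x) <= gamma N x, one gets
   N (G^* x) <= (1 + M c1) N (F^* x) + M c0 N (G^* x),
   so G^* has N-norm at most (1 + M c1) / (1 - M c0) * gamma. *)
Require Import Defs.
From HB Require Import structures.
From mathcomp Require Import all_boot all_order all_algebra complex.
From mathcomp Require Import all_classical all_reals.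
From mathcomp Require Import ereal topology normedtype sequences.
From mathcomp Require Import ring lra.

Set Implicit Arguments.
Unset Strict Implicit.
Unset Printing Implicit Defensive.

Import Order.TTheory GRing.Theory Num.Theory.
Import numFieldNormedType.Exports.

Local Open Scope classical_set_scope.
Local Open Scope ring_scope.

(** * Equivalent norms and perturbation of power bounds *)

Lemma rnormN (R : realType) (V : normedZmodType R[i]) (x : V) :
  rnorm (- x) = rnorm x.
Proof. by rewrite /rnorm normrN. Qed.

(** The power bound makes the supremum finite, the index 0 gives the lower bound, and applying [F]
    shifts the index by one, which costs a factor [gamma]. *)
Lemma equivalent_norm (R : realType) (V : normedModType R[i]) (F : V -> V)
    (M gamma : R) :
  linear F -> 0 < gamma ->
  (forall k x, rnorm (iter k F x) <= M * gamma ^+ k * rnorm x) ->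
  exists N : V -> R, [/\ forall x, rnorm x <= N x, forall x, N x <= M * rnorm x,
    forall x, N (F x) <= gamma * N x & forall x y, N (x + y) <= N x + N y].
Proof.
move=> lF g0 HF.
have FD x y : F (x + y) = F x + F y by have := lF 1 x y; rewrite !scale1r.
have iterD k x y : iter k F (x + y) = iter k F x + iter k F y.
  by elim: k => // k IH; rewrite !iterS IH FD.
have gk k : 0 < gamma ^+ k by rewrite exprn_gt0.
pose A x := [set rnorm (iter k F x) / gamma ^+ k | k in [set: nat]].
have ubA x : ubound (A x) (M * rnorm x).
  by move=> _ [k _ <-]; rewrite ler_pdivrMr // mulrAC.
have A0 x : A x !=set0 by exists (rnorm (iter 0 F x) / gamma ^+ 0), 0%N.
have Ale x k : rnorm (iter k F x) / gamma ^+ k <= sup (A x).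
  by apply: ub_le_sup; [exists (M * rnorm x) | exists k].
exists (fun x => sup (A x)); split => [x|x|x|x y].
- by have := Ale x 0%N; rewrite expr0 divr1.
- exact: ge_sup.
- apply: ge_sup => // _ [k _ <-]; rewrite -iterSr.
  rewrite -ler_pdivrMl // mulrCA -invfM -exprS; exact: Ale.
- apply: ge_sup => // _ [k _ <-]; rewrite iterD.
  apply: le_trans (lerD (Ale x k) (Ale y k)).
  by rewrite -mulrDl ler_pM2r ?invr_gt0 // rnormD.
Qed.

(** [E] is controlled by the perturbed map [G] itself, so its contribution is absorbed on the left,
    which requires [M * c0 < 1]. The iteration runs in the norm [N], hence [M] enters in front of
    the power only once. *)
Lemma power_bound_perturbation (R : realType) (V : normedModType R[i])
    (F G D E : V -> V) (M gamma c1 c0 : R) :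
  linear F -> 0 < gamma -> 0 <= M -> 0 <= c1 -> 0 <= c0 -> M * c0 < 1 ->
  (forall k x, rnorm (iter k F x) <= M * gamma ^+ k * rnorm x) ->
  (forall x, G x = F x - D x + E x) ->
  (forall x, rnorm (D x) <= c1 * rnorm (F x)) ->
  (forall x, rnorm (E x) <= c0 * rnorm (G x)) ->
  forall k x, rnorm (iter k G x) <=
    M * ((1 + M * c1) / (1 - M * c0) * gamma) ^+ k * rnorm x.
Proof.
move=> lF g0 M0 c10 c00 Mc0 HF GE DF EG k x.
have [N [N_ge N_le NF ND]] := equivalent_norm lF g0 HF.
set gt := _ / _ * _.
have p1 : 0 < 1 - M * c0 by rewrite subr_gt0.
have gtE : (1 - M * c0) * gt = (1 + M * c1) * gamma.
  by rewrite /gt; field; rewrite gt_eqF.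
have NG y : N (G y) <= gt * N y.
  have D_le : N (- D y) <= M * c1 * N (F y).
    apply: le_trans (N_le _) _; rewrite rnormN -mulrA ler_wpM2l //.
    by apply: le_trans (DF y) _; rewrite ler_wpM2l.
  have E_le : N (E y) <= M * c0 * N (G y).
    apply: le_trans (N_le _) _; rewrite -mulrA ler_wpM2l //.
    by apply: le_trans (EG y) _; rewrite ler_wpM2l.
  have G_le : N (G y) <= N (F y) + N (- D y) + N (E y).
    by rewrite {1}GE; apply: le_trans (ND _ _) _; rewrite lerD2r.
  have H : (1 - M * c0) * N (G y) <= (1 + M * c1) * (gamma * N y).
    (* The term [M * c0 * N (G y)] from [E_le] is moved to the left of [G_le]. *)
    apply: (@le_trans _ _ ((1 + M * c1) * N (F y))); first lra.
    by rewrite ler_wpM2l ?addr_ge0 ?mulr_ge0.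
  by rewrite -(ler_pM2l p1) mulrA gtE -mulrA.
have gt_ge0 : 0 <= gt.
  by rewrite -(pmulr_rge0 _ p1) gtE mulr_ge0 ?(ltW g0) ?addr_ge0 ?mulr_ge0.
have NGk : N (iter k G x) <= gt ^+ k * N x.
  elim: k => [|k IH]; first by rewrite expr0 mul1r.
  by rewrite iterS exprS -mulrA; apply: le_trans (NG _) _; rewrite ler_wpM2l.
apply: le_trans (N_ge _) _; apply: le_trans NGk _.
by rewrite (mulrC M) -mulrA ler_wpM2l ?exprn_ge0.
Qed.

(** * Bounded operators and the operator norm *)

Section bounded_operators.
Variable R : realType.
Implicit Types X Y Z : normedModType R[i].

(** The constant in [bounded_op] carries no sign; its absolute value can be used as a factor in
    inequalities. *)
Lemma bounded_opP X Y (T : X -> Y) : bounded_op T ->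
  exists2 C : R, 0 <= C & forall x, rnorm (T x) <= C * rnorm x.
Proof.
move=> [_ [C HC]]; exists `|C| => // x.
by apply: le_trans (HC x) _; rewrite ler_wpM2r ?rnorm_ge0 ?ler_norm.
Qed.

Lemma bounded_op_comp X Y Z (S : Y -> Z) (T : X -> Y) :
  bounded_op S -> bounded_op T -> bounded_op (S \o T).
Proof.
move=> bS bT; split; first by move=> a u v /=; rewrite bT.1 bS.1.
have [C C0 HC] := bounded_opP bS; have [D D0 HD] := bounded_opP bT.
exists (C * D) => x; apply: le_trans (HC _) _.
by rewrite -mulrA ler_wpM2l.
Qed.

Lemma bounded_op_id X : bounded_op (@id X).
Proof. by split => //; exists 1 => x; rewrite mul1r. Qed.

Lemma bounded_opD X Y (S T : X -> Y) :
  bounded_op S -> bounded_op T -> bounded_op (S \+ T).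
Proof.
move=> bS bT; split.
  by move=> a u v /=; rewrite bS.1 bT.1 scalerDr addrACA.
have [[_ [C HC]] [_ [D HD]]] := (bS, bT).
exists (C + D) => x; apply: le_trans (rnormD _ _) _.
by rewrite mulrDl lerD.
Qed.

Lemma bounded_op_iter X (T : X -> X) k : bounded_op T -> bounded_op (iter k T).
Proof.
move=> bT; elim: k => [|k IH]; first exact: bounded_op_id.
exact: (bounded_op_comp bT IH).
Qed.

Lemma bounded_op_cvg X Y (T : X -> Y) (u : nat -> X) (l : X) :
  bounded_op T -> u @ \oo --> l -> T \o u @ \oo --> T l.
Proof.
move=> bT ul; have [C C0 HC] := bounded_opP bT.
have TB x y : T (x - y) = T x - T y.
  by rewrite addrC -scaleN1r bT.1 scaleN1r addrC.
apply/cvgrPdist_le => e e0.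
have eE : e = (complex.Re e)%:C%C.
  by have := ger0_Im (ltW e0); case: (e) => ? ? /= ->.
have e0' : 0 < complex.Re e by rewrite -ltcR -eE.
(* Dividing by [C + 1] covers the case [C = 0]. *)
have C1 : 0 < C + 1 by rewrite ltr_wpDl.
have d0 : 0 < (complex.Re e / (C + 1))%:C%C by rewrite ltcR divr_gt0.
move/cvgrPdist_le : ul => /(_ _ d0); apply: filterS => n.
rewrite rnormE lecR ler_pdivlMr // => le_e.
rewrite /= -TB rnormE eE lecR; apply: le_trans (HC _) _.
by apply: le_trans le_e; rewrite mulrC ler_wpM2l ?rnorm_ge0 ?lerDl.
Qed.

Lemma opnorm_ge X Y (T : X -> Y) x :
  bounded_op T -> rnorm (T x) <= opnorm T * rnorm x.
Proof.
move=> bT; have [C C0 HC] := bounded_opP bT.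
have T0 : T 0 = 0.
  by have := bT.1 (-1) 0 0; rewrite scaler0 addr0 scaleN1r addNr.
have TZ a y : T (a *: y) = a *: T y by have := bT.1 a y 0; rewrite T0 !addr0.
have [->|x0] := eqVneq x 0; first by rewrite T0 /rnorm !normr0 mulr0.
have nx : 0 < rnorm x by rewrite -ltcR -rnormE normr_gt0.
rewrite -ler_pdivrMr //.
have rV : rnorm ((rnorm x)^-1%:C%C : R[i]) = (rnorm x)^-1.
  by rewrite [LHS]/rnorm ger0_norm // ler0c invr_ge0 ltW.
apply: ub_le_sup.
  exists C => _ [y /= y1 <-]; apply: le_trans (HC y) _.
  by rewrite -[leRHS]mulr1 ler_wpM2l.
exists ((rnorm x)^-1%:C%C *: x) => /=.
  by rewrite rnormZ rV mulVf ?gt_eqF.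
by rewrite TZ rnormZ rV mulrC.
Qed.

Lemma opnorm_le X Y (T : X -> Y) (C : R) : 0 <= C ->
  (forall x, rnorm (T x) <= C * rnorm x) -> opnorm T <= C.
Proof.
move=> C0 HC; apply: ge_sup.
  by exists (rnorm (T 0)), 0 => //=; rewrite /rnorm normr0.
move=> _ [x /= x1 <-]; apply: le_trans (HC x) _.
by rewrite -[leRHS]mulr1 ler_wpM2l.
Qed.

End bounded_operators.

(** * Calculus of adjoint pairs *)

Section adjoint_pairs.
Variable R : realType.

(** A relation, unlike [adjoint], gives explicit adjoints of compositions and blocks, and makes
    sense on [X * U], which is only an inner product space here, so that [adjointP] does not apply
    to it. *)
Definition is_adjoint (X Y : innerProductType R) (T : X -> Y) (S : Y -> X) :=
  forall x y, inner (T x) y = inner x (S y).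

Lemma is_adjoint_comp (X Y Z : innerProductType R) (S : Y -> Z) (T : X -> Y)
    (S' : Z -> Y) (T' : Y -> X) :
  is_adjoint S S' -> is_adjoint T T' -> is_adjoint (S \o T) (T' \o S').
Proof. by move=> aS aT x y; rewrite /= aS aT. Qed.

Lemma is_adjoint_iter (X : innerProductType R) (T S : X -> X) k :
  is_adjoint T S -> is_adjoint (iter k T) (iter k S).
Proof.
move=> aT; elim: k => // k IH x y.
by rewrite iterSr IH aT -iterS.
Qed.

Lemma inner_conj (X : innerProductType R) (x y : X) :
  inner x y = (inner y x)^*%R.
Proof. by rewrite hermC expr0 mul1r. Qed.

Lemma is_adjoint_sym (X Y : innerProductType R) (T : X -> Y) (S : Y -> X) :
  is_adjoint T S -> is_adjoint S T.
Proof. by move=> aT x y; rewrite inner_conj -aT -inner_conj. Qed.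

Lemma is_adjoint_col (Z X U : innerProductType R) (S : Z -> X) (T : Z -> U)
    (S' : X -> Z) (T' : U -> Z) :
  is_adjoint S S' -> is_adjoint T T' ->
  is_adjoint (col_op S T : Z -> (X * U)%type) (row_op S' T').
Proof.
by move=> aS aT z p; rewrite /row_op linearDr /= -aS -aT.
Qed.

Lemma is_adjoint_row (X U Z : innerProductType R) (S : X -> Z) (T : U -> Z)
    (S' : Z -> X) (T' : Z -> U) :
  is_adjoint S S' -> is_adjoint T T' ->
  is_adjoint (row_op S T : (X * U)%type -> Z) (col_op S' T').
Proof.
by move=> aS aT; apply/is_adjoint_sym/is_adjoint_col; exact: is_adjoint_sym.
Qed.

Lemma inner_inj (X : innerProductType R) (u v : X) :
  (forall x, inner x u = inner x v) -> u = v.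
Proof.
move=> uv; apply/eqP; rewrite -subr_eq0 -(dnorm_eq0 inner).
by rewrite linearBr /= uv subrr.
Qed.

Lemma is_adjoint_linear (X Y : innerProductType R) (T : X -> Y) (S : Y -> X) :
  is_adjoint T S -> linear S.
Proof.
by move=> aT a u v; apply: inner_inj => x; rewrite -aT !linearPr /= -!aT.
Qed.

(** By Cauchy-Schwarz, |S y|^2 = <T (S y), y> <= C |S y| |y|; divide by |S y|. *)
Lemma is_adjoint_bound (X Y : hilbertType R) (T : X -> Y) (S : Y -> X) (C : R) :
  is_adjoint T S -> 0 <= C -> (forall x, rnorm (T x) <= C * rnorm x) ->
  forall y, rnorm (S y) <= C * rnorm y.
Proof.
move=> aT C0 HC y; have [/eqP S0|S0] := eqVneq (rnorm (S y)) 0.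
  by rewrite (eqP S0) mulr_ge0 ?rnorm_ge0.
have Sy : 0 < rnorm (S y) by rewrite lt_def S0 rnorm_ge0.
rewrite -(ler_pM2l Sy) -expr2.
have -> : rnorm (S y) ^+ 2 = rnorm (inner (T (S y)) y).
  by rewrite aT innerE [RHS]/rnorm ger0_norm // ler0c sqr_ge0.
apply: le_trans (rnorm_inner_le _ _) _.
by rewrite mulrA (mulrC (rnorm _) C) ler_wpM2r ?rnorm_ge0.
Qed.

(** Since <S (S' y), y> = |S' y|^2, the operator inequality compares squared norms. This decodes
    both conditions of [noise_class], with [Y] equal to [X] or [X * U]. *)
Lemma op_le_adjoint (Y : innerProductType R) (Z : hilbertType R)
    (S T : Z -> Y) (S' T' : Y -> Z) (c : R) :
  is_adjoint S S' -> is_adjoint T T' -> 0 <= c ->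
  op_le (S \o S') ((c ^+ 2)%:C%C \*: (T \o T')) ->
  forall y, rnorm (S' y) <= c * rnorm (T' y).
Proof.
move=> aS aT c0 H y; have := H y.
rewrite linearBl /= linearZl_LR /= aS aT !innerE -rmorphM -rmorphB /= ler0c subr_ge0.
by rewrite -exprMn ler_sqr ?nnegrE ?mulr_ge0 ?rnorm_ge0.
Qed.

End adjoint_pairs.

(** * From the data equation to the inclusion of system classes *)

(** Weighting the k-th equation by [w k] and summing, [A] and [B] pass through the partial sums by
    linearity and through the limit by continuity; both sides are then limits of one series. *)
Lemma synthesis_relation (R : realType) (X U : hilbertType R)
    (x1 d1 x0 d0 : nat -> X) (u0 t0 : nat -> U) (A : X -> X) (B : U -> X) :
  bessel x1 -> bessel d1 -> bessel x0 -> bessel d0 -> bessel u0 -> bessel t0 ->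
  bounded_op A -> bounded_op B ->
  (forall k, x1 k - d1 k = A (x0 k - d0 k) + B (u0 k - t0 k)) ->
  forall w, synthesis x1 w - synthesis d1 w =
    A (synthesis x0 w - synthesis d0 w) + B (synthesis u0 w - synthesis t0 w).
Proof.
move=> bx1 bd1 bx0 bd0 bu0 bt0 bA bB rel w.
have sB (Y : hilbertType R) (a b : nat -> Y) : bessel a -> bessel b ->
    series (fun k => w k *: (a k - b k)) @ \oo --> synthesis a w - synthesis b w.
  move=> /synthesis_cvg/(_ w) ca /synthesis_cvg/(_ w) cb.
  rewrite (_ : series _ = series (fun k => w k *: a k) - series (fun k => w k *: b k)).
    exact: cvgB.
  apply/funext => n; rewrite /series /= -[RHS]/(_ - _) -sumrB.
  by apply: eq_bigr => k _; rewrite scalerBr.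
have sT (Y : hilbertType R) (T : Y -> X) (a : nat -> Y) : bounded_op T ->
    series (fun k => w k *: T (a k)) = T \o series (fun k => w k *: a k).
  move=> [lT _]; pose T' : {linear Y -> X} := HB.pack T (GRing.isLinear.Build _ _ _ _ T lT).
  apply/funext => n; rewrite /series /= -[T]/(T' : _ -> _) linear_sum.
  by apply: eq_bigr => k _; rewrite linearZ.
apply: (@cvg_unique X _ (series (fun k => w k *: (x1 k - d1 k)) @ \oo)).
- exact: norm_hausdorff.
- exact: sB.
- rewrite (_ : series _ = (A \o series (fun k => w k *: (x0 k - d0 k))) +
    (B \o series (fun k => w k *: (u0 k - t0 k)))).
    by apply: cvgD; apply: bounded_op_cvg => //; exact: sB.
  rewrite -!sT //; apply/funext => n; rewrite /series -[RHS]/(_ + _) -big_split /=.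
  by apply: eq_bigr => k _; rewrite rel scalerDr.
Qed.

Lemma Sigma_is_sub_Sigma_stab (R : realType) (X U : hilbertType R)
    (x1 x0 : nat -> X) (u0 : nat -> U) (Xi0d : X -> ell2 R) (M gamma c1 c0 : R) :
  bessel x1 -> bessel x0 -> bessel u0 -> bounded_op Xi0d ->
  (forall x, synthesis x0 (Xi0d x) = x) ->
  0 <= M -> 0 < gamma -> 0 <= c1 -> 0 <= c0 -> M * c0 < 1 ->
  (forall k : nat, opnorm (iter k (synthesis x1 \o Xi0d)) <= M * gamma ^+ k) ->
  Sigma_is x1 x0 u0 c1 c0 Xi0d `<=`
  Sigma_stab (synthesis u0 \o Xi0d) M ((1 + M * c1) / (1 - M * c0) * gamma).
Proof.
move=> bx1 bx0 bu0 bO Xi0dK M0 g0 c10 c00 Mc0 pb [A B] /=.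
move=> [/= bA bB [d1 [d0 [t0 [[[bd1 bd0 bt0] [le1 le0]] rel]]]]].
split=> //= k.
have adj (Y Z : hilbertType R) (T : Y -> Z) : bounded_op T -> is_adjoint T (adjoint T).
  exact: adjointP.
have sadj (Y : hilbertType R) (eta : nat -> Y) : bessel eta ->
    is_adjoint (synthesis eta) (adjoint (synthesis eta)).
  by move=> /synthesis_bounded; exact: adj.
have aO := adj _ _ _ bO; have aA := adj _ _ _ bA; have aB := adj _ _ _ bB.
(* With P and Q the columns of data and of noise composed with [Xi0d], the pairs below belong to F,
   D, P, Q, G = [A B] P and E = [A B] Q. *)
have aF := is_adjoint_comp (sadj _ _ bx1) aO.
have aD := is_adjoint_comp (sadj _ _ bd1) aO.
have aP := is_adjoint_comp (is_adjoint_col (sadj _ _ bx0) (sadj _ _ bu0)) aO.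
have aQ := is_adjoint_comp (is_adjoint_col (sadj _ _ bd0) (sadj _ _ bt0)) aO.
have aG := is_adjoint_comp (is_adjoint_row aA aB) aP.
have aE := is_adjoint_comp (is_adjoint_row aA aB) aQ.
have DF := op_le_adjoint aD aF c10 le1.
(* At the point (A^* y, B^* y) of [X * U] this bounds E^* y by [c0] times G^* y. *)
have QP := op_le_adjoint aQ aP c00 le0.
set F' := adjoint _ \o _ in aF; set D' := adjoint _ \o _ in aD.
set G' := (_ \o _) \o col_op _ _ in aG; set E' := (_ \o _) \o col_op _ _ in aE.
set G := _ \+ _.
(* As [Xi0d] is a right inverse, the state block of P is the identity and [A B] P = A + B K. *)
have GE x : G x = (row_op A B \o (col_op (synthesis x0) (synthesis u0) \o Xi0d)) x.
  by rewrite /= /row_op /= Xi0dK.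
(* Paired with an arbitrary [x], this is the synthesized data equation at [Xi0d x], with the noise
   terms of E added back. *)
have G'E y : G' y = F' y - D' y + E' y.
  apply: inner_inj => x; rewrite linearDr linearBr /= -[inner x (G' y)]aG -[inner x (F' y)]aF.
  rewrite -[inner x (D' y)]aD -[inner x (E' y)]aE -linearBl -linearDl; congr (inner _ y).
  have := synthesis_relation bx1 bd1 bx0 bd0 bu0 bt0 bA bB rel (Xi0d x).
  rewrite /= /row_op /= => ->.
  have opK (Y : hilbertType R) (T : Y -> X) u v : bounded_op T -> T (u - v) + T v = T u.
    by move=> [lT _]; have := lT 1 (u - v) v; rewrite !scale1r subrK.
  by rewrite Xi0dK addrACA !opK.
have bG : bounded_op G.
  by apply: bounded_opD => //; do ! apply: bounded_op_comp => //; exact: synthesis_bounded.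
have {}aG : is_adjoint G G' by move=> x y; rewrite GE; exact: aG.
have F_le j x : rnorm (iter j (synthesis x1 \o Xi0d) x) <= M * gamma ^+ j * rnorm x.
  apply: le_trans (opnorm_ge _ _) _.
    apply: bounded_op_iter; apply: bounded_op_comp => //; exact: synthesis_bounded.
  by rewrite ler_wpM2r ?rnorm_ge0.
have F'_le j : forall x, rnorm (iter j F' x) <= M * gamma ^+ j * rnorm x.
  apply: is_adjoint_bound (is_adjoint_iter j aF) _ (F_le j).
  by rewrite mulr_ge0 ?exprn_ge0 ?(ltW g0).
have C_ge0 : 0 <= M * ((1 + M * c1) / (1 - M * c0) * gamma) ^+ k.
  by rewrite mulr_ge0 ?exprn_ge0 ?mulr_ge0 ?(ltW g0) ?invr_ge0 ?subr_ge0 ?(ltW Mc0)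
    ?addr_ge0 ?mulr_ge0.
apply: opnorm_le => //.
(* The bound is proved for the powers of [G'] and carried back to those of [G] with the same
   constant. *)
apply: is_adjoint_bound (is_adjoint_sym (is_adjoint_iter k aG)) C_ge0 _.
by apply: (power_bound_perturbation (is_adjoint_linear aF) g0 M0 c10 c00 Mc0 F'_le G'E DF)
  => x; exact: QP.
Qed.

Theorem theorem5p3 (R : realType) (X U : hilbertType R)
    (x1 x0 : nat -> X) (u0 : nat -> U) (Xi0d : X -> ell2 R) (M gamma : R)
    (X_nontrivial : exists x : X, x != 0)
    (U_nontrivial : exists u : U, u != 0)
    (x1_bessel : bessel x1) (x0_bessel : bessel x0) (u0_bessel : bessel u0)
    (x0_frame : frame x0)
    (Xi0d_bounded : bounded_op Xi0d)
    (Xi0d_right_inverse : forall x, synthesis x0 (Xi0d x) = x)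
    (M_ge1 : 1 <= M) (gamma_gt0 : 0 < gamma)
    (power_bound : forall k : nat,
      opnorm (iter k (synthesis x1 \o Xi0d)) <= M * gamma ^+ k) :
  let K : X -> U := synthesis u0 \o Xi0d in
  let gammat (c1 c0 : R) : R := (1 + M * c1) / (1 - M * c0) * gamma in
  [/\ bounded_op K,
      forall c1 c0 : R, 0 <= c1 -> 0 <= c0 -> c0 < 1 / M ->
        0 < gammat c1 c0 /\
        Sigma_is x1 x0 u0 c1 c0 Xi0d `<=` Sigma_stab K M (gammat c1 c0) &
      forall c1 c0 : R, 0 <= c1 -> 0 <= c0 ->
        gamma * c1 + c0 < (1 - gamma) / M ->
        0 < gammat c1 c0 < 1 /\
        informative x1 x0 u0 (gammat c1 c0) c1 c0 Xi0d].
Proof.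
move=> K gammat.
have M0 : 0 < M by lra.
have bK : bounded_op K.
  by apply: bounded_op_comp => //; exact: synthesis_bounded.
have stab c1 c0 : 0 <= c1 -> 0 <= c0 -> c0 < 1 / M -> 0 < gammat c1 c0 /\
    Sigma_is x1 x0 u0 c1 c0 Xi0d `<=` Sigma_stab K M (gammat c1 c0).
  move=> c10 c00; rewrite ltr_pdivlMr // mulrC => Mc0; split.
    by rewrite mulr_gt0 // divr_gt0 ?subr_gt0 // ltr_wpDr ?mulr_ge0 // ltW.
  by apply: Sigma_is_sub_Sigma_stab => //; exact: ltW.
split=> // c1 c0 c10 c00; rewrite ltr_pdivlMr // => small.
have Mgc1 : 0 <= M * (gamma * c1) by rewrite mulr_ge0 ?mulr_ge0 ?(ltW M0) ?(ltW gamma_gt0).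
(* Dropping the nonnegative term [M * (gamma * c1)] from [small] leaves [M * c0 < 1 - gamma]. *)
have Mc0 : M * c0 < 1 by lra.
have [gt0 sub] : 0 < gammat c1 c0 /\
    Sigma_is x1 x0 u0 c1 c0 Xi0d `<=` Sigma_stab K M (gammat c1 c0).
  by apply: stab; rewrite // ltr_pdivlMr // mulrC.
split; last by exists K, M.
(* With the denominator cleared, the claim is [(1 + M * c1) * gamma < 1 - M * c0], a rearrangement
   of [small]. *)
by rewrite gt0 /= /gammat mulrAC ltr_pdivrMr ?subr_gt0 // mul1r; lra.
Qed.
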